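(* Let $C_1,C_2\subset\mathbf{R}^3$ be matching log-circles. Then $(C_1,C_2)$ spans few distances, i.e., for all positive integers $m,n$ there exist $\mathcal P_1\subset C_1$ with $|\mathcal P_1|=m$ and $\mathcal P_2\subset C_2$ with $|\mathcal P_2|=n$ such that the number of distinct distances $|pq|$, $p\in\mathcal P_1,q\in\mathcal P_2$, is $O(m+n)$.
   Context: For $A,B,D\in\mathbf{R}$, consider $\{(x,y,0): x^2+y^2=D+A\ln|x-B|\}$; a log-circle is any image of such a set under a rotation and translation of $\mathbf{R}^3$. Two log-circles match if they can be obtained by applying a rotation, translation and scaling of $\mathbf{R}^3$ to the pair $\{(x,y,0): (x-B)^2+y^2=D+A\ln|x|\}$ and $\{(x,0,z): x^2+z^2=D'+A\ln|x-B|\}$ for some $A,B,D,D'\in\mathbf{R}$.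
   Formalization: Both log-circles are assumed to be infinite sets: for some parameters (e.g. A = 0, D < 0) the defining equation gives an empty or finite set, for which the claim fails; the conclusion itself forces both curves to be infinite. *)

(* Defs.v *)
From HB Require Import structures.
From mathcomp Require Import all_boot all_order all_algebra finmap.
From mathcomp Require Import boolp classical_sets functions cardinality.
From mathcomp Require Import reals exp.

Set Implicit Arguments.
Unset Strict Implicit.
Unset Printing Implicit Defensive.

Import Order.TTheory GRing.Theory Num.Theory.
Local Open Scope classical_set_scope.
Local Open Scope ring_scope.

Definition point3 (R : realType) (x y z : R) : 'rV[R]_3 :=
  \row_(i < 3) [:: x; y; z]`_i.

(* The norm that the library puts on 'rV[R]_3 is the sup norm, hence this
   explicit Euclidean distance. *)
Definition edist (R : realType) (p q : 'rV[R]_3) : R :=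
  Num.sqrt (\sum_(i < 3) (p 0 i - q 0 i) ^+ 2).

Definition rotation_mx (R : realType) (M : 'M[R]_3) : Prop :=
  M *m M^T = 1%:M /\ \det M = 1.

Definition rigid_motion (R : realType) (M : 'M[R]_3) (v p : 'rV[R]_3) :
    'rV[R]_3 :=
  p *m M + v.

(* Every composition of rotations, translations and scalings has this form,
   with M a rotation and 0 < s. *)
Definition similarity (R : realType) (s : R) (M : 'M[R]_3) (v p : 'rV[R]_3) :
    'rV[R]_3 :=
  s *: (p *m M) + v.

(* [log_defined A t]: the expression A * ln |t| is meaningful.  The library has
   ln 0 = 0, so points with t = 0 have to be excluded explicitly; when A = 0
   the term is read as 0 for every t, so that the curves below are then full
   circles. *)
Definition log_defined (R : realType) (A t : R) : Prop := A != 0 -> t != 0.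

(* For some parameters (e.g. A = 0 and D <= 0) this set is empty or finite;
   statements about genuine curves have to assume infiniteness separately. *)
Definition std_log_circle (R : realType) (A B D : R) : set 'rV[R]_3 :=
  [set p | exists x y : R,
    [/\ p = point3 x y 0, log_defined A (x - B)
      & x ^+ 2 + y ^+ 2 = D + A * ln `|x - B|]].

Definition log_circle (R : realType) (C : set 'rV[R]_3) : Prop :=
  exists (A B D : R) (M : 'M[R]_3) (v : 'rV[R]_3),
    rotation_mx M /\ C = rigid_motion M v @` std_log_circle A B D.

Definition std_match1 (R : realType) (A B D : R) : set 'rV[R]_3 :=
  [set p | exists x y : R,
    [/\ p = point3 x y 0, log_defined A x
      & (x - B) ^+ 2 + y ^+ 2 = D + A * ln `|x|]].

Definition std_match2 (R : realType) (A B D' : R) : set 'rV[R]_3 :=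
  [set p | exists x z : R,
    [/\ p = point3 x 0 z, log_defined A (x - B)
      & x ^+ 2 + z ^+ 2 = D' + A * ln `|x - B|]].

Definition matching (R : realType) (C1 C2 : set 'rV[R]_3) : Prop :=
  exists (A B D D' s : R) (M : 'M[R]_3) (v : 'rV[R]_3),
    [/\ 0 < s, rotation_mx M,
        C1 = similarity s M v @` std_match1 A B D
      & C2 = similarity s M v @` std_match2 A B D'].

Definition distances (R : realType) (P1 P2 : {fset 'rV[R]_3}) : {fset R} :=
  [fset edist p q | p in P1, q in P2]%fset.

(* The constant K hidden in O(m + n) may depend on the two curves, but not on
   m and n. *)
Definition spans_few_distances (R : realType) (C1 C2 : set 'rV[R]_3) : Prop :=
  exists K : nat, forall m n : nat, (0 < m)%N -> (0 < n)%N ->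
    exists P1 P2 : {fset 'rV[R]_3},
      [/\ [set` P1] `<=` C1, #|` P1| = m,
          [set` P2] `<=` C2, #|` P2| = n
        & (#|` distances P1 P2| <= K * (m + n))%N].

(* Main.v *)
(** In matching position, write a point of the first curve as [(x, y, 0)] and a
    point of the second one as [(B + t, 0, z)].  Substituting the two curve
    equations, the squared distance becomes
    [D + D' - B^2 + A ln |x t| - 2 x t], a function of the product [x t] alone.
    Hence geometric progressions of [x] and [t] with a common ratio give at most
    [m + n] distances.  An infinite curve has room for such progressions: the
    admissible abscissas contain an arc [x0 e^s, |s| < d].  For [A >= 0] this
    follows from strict concavity of [D + A ln |x| - (x - B)^2] on each
    half-line, for [A < 0] from its blow-up at [0]. *)
(* Imported before Defs, whose [edist] the library's [edist] would shadow. *)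
From mathcomp Require Import topology normedtype sequences ring lra.
Require Import Defs.
From HB Require Import structures.
From mathcomp Require Import all_boot all_order all_algebra finmap.
From mathcomp Require Import boolp classical_sets functions cardinality.
From mathcomp Require Import reals exp.

Set Implicit Arguments.
Unset Strict Implicit.
Unset Printing Implicit Defensive.

Import Order.TTheory GRing.Theory Num.Theory.
Import numFieldNormedType.Exports.
Local Open Scope classical_set_scope.
Local Open Scope ring_scope.

(** * Effect of similarities on distances *)

Section Similarities.
Variable R : realType.
Implicit Types (M : 'M[R]_3) (p q v : 'rV[R]_3).

(** The sum of squares is the single entry of [v *m v^T], and [M *m M^T] cancels inside
    [(v *m M) *m (v *m M)^T]. *)
Lemma sum_sqr_mulmx M v : M *m M^T = 1%:M ->
  \sum_(i < 3) (v *m M) 0 i ^+ 2 = \sum_(i < 3) v 0 i ^+ 2.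
Proof.
have dotE (u : 'rV[R]_3) : \sum_(i < 3) u 0 i ^+ 2 = (u *m u^T) 0 0.
  by rewrite mxE; apply: eq_bigr => i _; rewrite mxE expr2.
move=> MMT; rewrite !dotE trmx_mul mulmxA -(mulmxA v).
by rewrite MMT mulmx1.
Qed.

Lemma edist_similarity s M v p q : 0 < s -> rotation_mx M ->
  edist (similarity s M v p) (similarity s M v q) = s * edist p q.
Proof.
move=> s0 [MMT _]; rewrite /edist.
have -> : \sum_(i < 3) (similarity s M v p 0 i - similarity s M v q 0 i) ^+ 2
    = s ^+ 2 * \sum_(i < 3) (p 0 i - q 0 i) ^+ 2.
  transitivity (s ^+ 2 * \sum_(i < 3) ((p - q) *m M) 0 i ^+ 2).
    rewrite mulr_sumr; apply: eq_bigr => i _.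
    rewrite mulmxBl /similarity !mxE -exprMn; congr (_ ^+ 2); ring.
  rewrite sum_sqr_mulmx //; congr (_ * _).
  by apply: eq_bigr => i _; rewrite !mxE.
by rewrite sqrtrM ?sqr_ge0// sqrtr_sqr gtr0_norm.
Qed.

Lemma similarity_inj s M v : 0 < s -> rotation_mx M ->
  injective (similarity s M v).
Proof.
move=> s0 [MMT _] p q /addIr/(scalerI (lt0r_neq0 s0)) pq.
by rewrite -[p]mulmx1 -MMT mulmxA pq -mulmxA MMT mulmx1.
Qed.

Lemma edist_point3 (x y u z : R) :
  edist (point3 x y 0) (point3 u 0 z)
  = Num.sqrt ((x - u) ^+ 2 + y ^+ 2 + z ^+ 2).
Proof.
rewrite /edist !big_ord_recr big_ord0 /= !mxE /=.
by congr Num.sqrt; ring.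
Qed.

Lemma point3_inj (x y z x' y' z' : R) :
  point3 x y z = point3 x' y' z' -> [/\ x = x', y = y' & z = z'].
Proof.
move=> e; have E (i : 'I_3) := congr1 (fun w : 'rV_3 => w 0 i) e.
by move: (E 0) (E 1) (E (inord 2)); rewrite !mxE !inordK.
Qed.

End Similarities.

(** * Room on an infinite curve: an arc of admissible abscissas *)

Section Abscissas.
Variable R : realType.
Implicit Types A B D : R.

(** The inequality says that the curve equation can be solved for the remaining coordinate. With
    [t = x - B] the second curve takes the same form with [- B] for [B]. *)
Definition abscissas A B D : set R :=
  [set x | log_defined A x /\ (x - B) ^+ 2 <= D + A * ln `|x|].

Lemma infinite_set_neq (T : Type) (X : set T) : infinite_set X ->
  exists a b, [/\ X a, X b & a <> b].
Proof.
move=> Xinf; have [a Xa] := infinite_setN0 Xinf.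
have [b [Xb ba]] : X `\ a !=set0.
  by apply: infinite_setN0; apply: infinite_setD (finite_set1 a).
by exists a, b; split => // ab; apply: ba.
Qed.

(** Otherwise each open half-line contains finitely many points of [X], and adding [0] covers [X]. A
    common sign keeps the segment from [a] to [b] away from the singularity of the logarithm. *)
Lemma infinite_set_same_sign (X : set R) : infinite_set X ->
  exists a b, [/\ X a, X b, a != b & 0 < a * b].
Proof.
move=> Xinf.
have [Pfin|/infinite_set_neq[a [b [[Xa a0] [Xb b0] /eqP ab]]]] :=
    pselect (finite_set (X `&` [set x | 0 < x])); last first.
  by exists a, b; split => //; apply: mulr_gt0.
have [Nfin|/infinite_set_neq[a [b [[Xa a0] [Xb b0] /eqP ab]]]] :=
    pselect (finite_set (X `&` [set x | x < 0])); last first.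
  by exists a, b; split => //; rewrite nmulr_rgt0.
exfalso; apply: Xinf; apply: (@sub_finite_set _ _
    ((X `&` [set x | 0 < x]) `|` (X `&` [set x | x < 0]) `|` [set 0])).
  move=> x Xx; have [x0|x0|->] := ltgtP x 0; last by right.
  - by left; right.
  - by left; left.
by rewrite !finite_setU.
Qed.

(** AM-GM in the form [a * b <= c ^+ 2] bounds the logarithmic term. Strictness comes from the
    square, whose midpoint value falls short of the average by [(a - b) ^+ 2 / 4], so [A = 0] is
    covered too. *)
Lemma midpoint_sqr_lt A B D a b : 0 <= A -> a != b -> 0 < a * b ->
  (a - B) ^+ 2 <= D + A * ln `|a| -> (b - B) ^+ 2 <= D + A * ln `|b| ->
  ((a + b) / 2 - B) ^+ 2 < D + A * ln `|(a + b) / 2|.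
Proof.
move=> A0 ab ab0 Ha Hb; set c := (a + b) / 2.
have d0 : 0 < (a - b) ^+ 2 by rewrite exprn_even_gt0 //= subr_eq0.
have cE : c ^+ 2 = a * b + (a - b) ^+ 2 / 4 by rewrite /c; field.
have c2 : a * b <= c ^+ 2 by lra.
have a0 : a != 0 by apply: contraTneq ab0 => ->; rewrite mul0r ltxx.
have b0 : b != 0 by apply: contraTneq ab0 => ->; rewrite mulr0 ltxx.
have c0 : c != 0.
  by apply: contraTneq (lt_le_trans ab0 c2) => ->; rewrite expr0n ltxx.
have lnD : ln `|a| + ln `|b| <= ln `|c| + ln `|c|.
  rewrite -!lnM ?posrE ?normr_gt0// -!normrM -expr2 (gtr0_norm ab0).
  by rewrite (ger0_norm (sqr_ge0 _)) ler_ln ?posrE// (lt_le_trans ab0).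
have AlnD := ler_wpM2l A0 lnD.
have -> : (c - B) ^+ 2 =
    ((a - B) ^+ 2 + (b - B) ^+ 2) / 2 - (a - b) ^+ 2 / 4 by rewrite /c; field.
lra.
Qed.

Lemma sqr_lt_near0 A B D : A < 0 ->
  exists2 x, x != 0 & (x - B) ^+ 2 < D + A * ln `|x|.
Proof.
(* At [x = expR (- k)] the term [A * ln x] equals [- A * k], which [k] makes exceed [(1 +]|B|) ^+ 2
   - D[; and](x - B) ^+ 2 <= (1 + [|B|) ^+ 2] because [0 < x <= 1]. *)
move=> A0; set k := (`|(1 + `|B|) ^+ 2 - D| + 1) / (- A).
have k0 : 0 <= k by rewrite /k divr_ge0 ?addr_ge0// oppr_ge0 ltW.
exists (expR (- k)); first by rewrite gt_eqF ?expR_gt0.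
rewrite gtr0_norm ?expR_gt0// expRK.
have -> : A * (- k) = `|(1 + `|B|) ^+ 2 - D| + 1.
  by rewrite /k; field; rewrite lt_eqF.
have : (expR (- k) - B) ^+ 2 <= (1 + `|B|) ^+ 2.
  rewrite -[leLHS]real_normK ?num_real// lerXn2r ?nnegrE ?addr_ge0//.
  rewrite (le_trans (ler_normB _ _))// lerD2r gtr0_norm ?expR_gt0//.
  by rewrite -expR0 ler_expR oppr_le0.
have := ler_norm ((1 + `|B|) ^+ 2 - D); lra.
Qed.

Lemma abscissas_arc A B D : infinite_set (abscissas A B D) ->
  exists x0 d, [/\ x0 != 0, 0 < d &
    forall s, `|s| < d -> abscissas A B D (x0 * expR s)].
Proof.
move=> Xinf.
have [x0 x0N0 x0lt] : exists2 x, x != 0 & (x - B) ^+ 2 < D + A * ln `|x|.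
  have [A0|A0] := ltP A 0; first exact: sqr_lt_near0.
  have [a [b [[_ Ha] [_ Hb] ab ab0]]] := infinite_set_same_sign Xinf.
  exists ((a + b) / 2); last exact: midpoint_sqr_lt.
  apply: contraTneq ab0 => c0; rewrite -leNgt.
  have -> : b = - a by move: c0; lra.
  by rewrite mulrN oppr_le0 -expr2 sqr_ge0.
(* The slack in the inequality at [x0 * expR s], with the logarithm already expanded, so that its
   continuity reduces to that of [expR]. *)
pose f (s : R) := D + A * (ln `|x0| + s) - (x0 * expR s - B) ^+ 2.
have fc : {for 0, continuous f}.
  apply: cvgB.
    apply: cvgD; first exact: cvg_cst.
    apply: cvgM; first exact: cvg_cst.
    by apply: cvgD; [exact: cvg_cst | exact: cvg_id].
  have g : (fun s : R => x0 * expR s - B) @ (0 : R) --> x0 * expR 0 - B.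
    apply: cvgB; last exact: cvg_cst.
    by apply: cvgM; [exact: cvg_cst | exact: continuous_expR].
  exact: (cvgM g g).
have f0 : 0 < f 0 by rewrite /f addr0 expR0 mulr1 subr_gt0.
have /nbhs_ballP[d /= d0 Hd] : \forall s \near (0 : R), 0 < f s.
  exact: (cvgr_gt _ fc).
exists x0, d; split=> // s sd.
have xsN0 : x0 * expR s != 0 by rewrite mulf_neq0// gt_eqF ?expR_gt0.
split; first by move=> _.
rewrite normrM (gtr0_norm (expR_gt0 s)) lnM ?posrE ?normr_gt0 ?expR_gt0// expRK.
rewrite -subr_ge0 ltW//; apply: Hd.
by rewrite /ball /= sub0r normrN.
Qed.

End Abscissas.

(** * Points on the two curves and their distances *)

Section Matching.
Variable R : realType.
Implicit Types A B D x t : R.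

Definition height A B D x : R := Num.sqrt (D + A * ln `|x| - (x - B) ^+ 2).

Lemma sqr_height A B D x : abscissas A B D x ->
  height A B D x ^+ 2 = D + A * ln `|x| - (x - B) ^+ 2.
Proof. by move=> [_ xP]; rewrite sqr_sqrtr// subr_ge0. Qed.

Lemma height_abs A B D x (y : R) : (x - B) ^+ 2 + y ^+ 2 = D + A * ln `|x| ->
  height A B D x = `|y|.
Proof. by move=> e; rewrite /height -e addrC addKr sqrtr_sqr. Qed.

Definition match1_pt A B D x : 'rV[R]_3 := point3 x (height A B D x) 0.

Definition match2_pt A B D t : 'rV[R]_3 :=
  point3 (t + B) 0 (height A (- B) D t).

Lemma std_match1_pt A B D x :
  abscissas A B D x -> std_match1 A B D (match1_pt A B D x).
Proof.
move=> xP; exists x, (height A B D x); split => //; first by case: xP.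
by rewrite sqr_height// addrC subrK.
Qed.

Lemma std_match2_pt A B D t :
  abscissas A (- B) D t -> std_match2 A B D (match2_pt A B D t).
Proof.
move=> tP; exists (t + B), (height A (- B) D t); rewrite addrK.
split => //; first by case: tP.
by rewrite sqr_height// opprK addrC subrK.
Qed.

Lemma match1_pt_inj A B D : injective (match1_pt A B D).
Proof. by move=> x x' /point3_inj[]. Qed.

Lemma match2_pt_inj A B D : injective (match2_pt A B D).
Proof. by move=> t t' /point3_inj[/addIr]. Qed.

(** Over each abscissa lie at most two points, with ordinates [height] and its opposite, so finitely
    many abscissas carry a finite curve. *)
Lemma infinite_std_match1 A B D :
  infinite_set (std_match1 A B D) -> infinite_set (abscissas A B D).
Proof.
move=> Cinf Xfin; apply: Cinf; set X := abscissas A B D in Xfin.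
apply: (@sub_finite_set _ _ ((match1_pt A B D @` X) `|`
    ((fun x => point3 x (- height A B D x) 0) @` X))).
  move=> _ [x [y [-> xd e]]].
  have Xx : X x by split => //; rewrite -e lerDl sqr_ge0.
  have [y0|y0] := leP 0 y; [left | right]; exists x => //.
    by rewrite /match1_pt (height_abs e) ger0_norm.
  by rewrite (height_abs e) ltr0_norm// opprK.
by rewrite finite_setU; split; apply: finite_image.
Qed.

Lemma infinite_std_match2 A B D :
  infinite_set (std_match2 A B D) -> infinite_set (abscissas A (- B) D).
Proof.
move=> Cinf Xfin; apply: Cinf; set X := abscissas A (- B) D in Xfin.
apply: (@sub_finite_set _ _ ((match2_pt A B D @` X) `|`
    ((fun t => point3 (t + B) 0 (- height A (- B) D t)) @` X))).
  move=> _ [x [z [-> xd e]]].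
  have {}e : (x - B - - B) ^+ 2 + z ^+ 2 = D + A * ln `|x - B|.
    by rewrite opprK subrK.
  have Xx : X (x - B) by split => //; rewrite -e lerDl sqr_ge0.
  have [z0|z0] := leP 0 z; [left | right]; exists (x - B) => //.
    by rewrite /match2_pt (height_abs e) subrK ger0_norm.
  by rewrite (height_abs e) subrK ltr0_norm// opprK.
by rewrite finite_setU; split; apply: finite_image.
Qed.

(** The linear terms cancel: [(x - (t + B)) ^+ 2 - (x - B) ^+ 2 - (t + B) ^+ 2] is
    [- B ^+ 2 - x * t *+ 2], and the two logarithms add up to that of the product. *)
Lemma edist_match_pt A B D D' x t : x != 0 -> t != 0 ->
  abscissas A B D x -> abscissas A (- B) D' t ->
  edist (match1_pt A B D x) (match2_pt A B D' t)
  = Num.sqrt (D + D' - B ^+ 2 + A * ln `|x * t| - x * t *+ 2).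
Proof.
move=> x0 t0 xP tP; rewrite edist_point3 !sqr_height//.
by rewrite normrM lnM ?posrE ?normr_gt0//; congr Num.sqrt; ring.
Qed.

End Matching.

(** * Counting distances between two progressions *)

Lemma card_distances_le (R : realType) (p q : nat -> 'rV[R]_3) (g : nat -> R)
    (m n : nat) :
  (forall i j, (i < m)%N -> (j < n)%N -> edist (p i) (q j) = g (i + j)%N) ->
  (#|` distances [fset p (val i) | i in 'I_m]%fset
                 [fset q (val j) | j in 'I_n]%fset| <= m + n)%N.
Proof.
move=> pq; rewrite -[leqRHS]card_ord.
apply: (@leq_trans #|` [fset g (val k) | k in 'I_(m + n)]%fset|).
  apply/fsubset_leq_card/fsubsetP => _ /imfset2P[_ /imfsetP[i /= _ ->]
    [_ /imfsetP[j /= _ ->] ->]].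
  have ijmn : (i + j < m + n)%N.
    by rewrite -addSn leq_add// ltnW.
  by apply/imfsetP; exists (Ordinal ijmn) => //=; rewrite pq.
by rewrite (leq_trans (leq_imfset_card _ _ _))// cardE.
Qed.

Lemma card_imfset_ord (T : choiceType) (p : nat -> T) (m : nat) :
  injective p -> #|` [fset p (val i) | i in 'I_m]%fset| = m.
Proof.
move=> pinj; rewrite card_imfset /=; first by rewrite -cardE card_ord.
by move=> i j /pinj/val_inj.
Qed.

Theorem theorem1p6 (R : realType) (C1 C2 : set 'rV[R]_3)
  (hC1 : log_circle C1) (hC2 : log_circle C2)
  (hC1inf : infinite_set C1) (hC2inf : infinite_set C2)
  (hmatch : matching C1 C2) :
  spans_few_distances C1 C2.
Proof.
have {hmatch} [A [B [D [D' [s [M [v [s0 rotM C1E C2E]]]]]]]] := hmatch.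
have [x0 [d [x0N0 d0 xP]]] : exists x0 d, [/\ x0 != 0, 0 < d &
    forall h, `|h| < d -> abscissas A B D (x0 * expR h)].
  apply/abscissas_arc/infinite_std_match1 => fin; apply: hC1inf.
  by rewrite C1E; apply: finite_image.
have [t0 [d' [t0N0 d'0 tP]]] : exists t0 d', [/\ t0 != 0, 0 < d' &
    forall h, `|h| < d' -> abscissas A (- B) D' (t0 * expR h)].
  apply/abscissas_arc/infinite_std_match2 => fin; apply: hC2inf.
  by rewrite C2E; apply: finite_image.
exists 1%N => m n m0 n0; rewrite mul1n.
(* Both progressions share the ratio [expR h]; this [h] keeps every exponent [h * i] with
   [i < m + n] inside both arcs. *)
pose h := Num.min d d' / (m + n)%:R.
have mn0 : 0 < (m + n)%:R :> R by rewrite ltr0n addn_gt0 m0.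
have h0 : 0 < h by rewrite divr_gt0// lt_min d0.
have hP i : (i < m + n)%N -> `|h * i%:R| < d /\ `|h * i%:R| < d'.
  move=> imn; apply/andP; rewrite -lt_min ger0_norm ?(mulr_ge0 (ltW h0))//.
  by rewrite /h mulrAC ltr_pdivrMr// ltr_pM2l ?ltr_nat// lt_min d0.
have progression_inj (a : R) : a != 0 -> injective (fun i : nat => a * expR (h * i%:R)).
  move=> aN0 i j /(mulfI aN0)/expR_inj/(mulfI (lt0r_neq0 h0))/eqP.
  by rewrite eqr_nat => /eqP.
pose x (i : nat) := x0 * expR (h * i%:R); pose t (j : nat) := t0 * expR (h * j%:R).
pose p i := similarity s M v (match1_pt A B D (x i)).
pose q j := similarity s M v (match2_pt A B D' (t j)).
have xiP i : (i < m)%N -> abscissas A B D (x i).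
  by move=> im; apply: xP; apply: (hP i _).1; rewrite ltn_addr.
have tjP j : (j < n)%N -> abscissas A (- B) D' (t j).
  by move=> jn; apply: tP; apply: (hP j _).2; rewrite ltn_addl.
exists [fset p (val i) | i in 'I_m]%fset, [fset q (val j) | j in 'I_n]%fset.
split.
- move=> _ /= /imfsetP[i /= _ ->]; rewrite C1E.
  by exists (match1_pt A B D (x i)) => //; apply/std_match1_pt/xiP.
- apply: card_imfset_ord => i j /(similarity_inj s0 rotM)/match1_pt_inj.
  exact: progression_inj.
- move=> _ /= /imfsetP[j /= _ ->]; rewrite C2E.
  by exists (match2_pt A B D' (t j)) => //; apply/std_match2_pt/tjP.
- apply: card_imfset_ord => i j /(similarity_inj s0 rotM)/match2_pt_inj.
  exact: progression_inj.
(* The product of the [i]-th and [j]-th abscissas depends only on [i + j], as [card_distances_le]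
   requires. *)
pose w k : R := x0 * t0 * expR (h * k%:R).
apply: (@card_distances_le _ p q (fun k => s * Num.sqrt
  (D + D' - B ^+ 2 + A * ln `|w k| - w k *+ 2))) => i j im jn.
have wE : x i * t j = w (i + j)%N.
  by rewrite /x /t /w natrD mulrDr expRD mulrACA.
rewrite edist_similarity// edist_match_pt ?wE//; [| |exact: xiP|exact: tjP].
- by rewrite mulf_neq0// gt_eqF ?expR_gt0.
- by rewrite mulf_neq0// gt_eqF ?expR_gt0.
Qed.
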